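(* Let $\mathcal{C}$ be a clutter on a finite set $E$, and suppose there is a clutter $\mathcal{D}$ on $E$ which is ideal and minimally non-packing with $\tilde{\mathcal{D}}=\mathcal{C}$. Then $\mathcal{C}$ satisfies the integral blocking condition, $\mathrm{I}(\mathcal{C})$ is an integral polytope, and $\mathcal{C}$ is non-separable.
   Context: A clutter on a finite set $E$ is a family of subsets of $E$ none containing another (members: hyperedges). A transversal is an inclusion-minimal subset of $E$ meeting every hyperedge; $\mathrm{b}(\mathcal{C})$ is the set of transversals, $\mathrm{bn}(\mathcal{C})$ the minimum transversal size, $\mathrm{minb}(\mathcal{C})$ the set of transversals of that size. $\mathrm{pn}(\mathcal{C})$ is the maximum number of pairwise disjoint hyperedges; $\mathcal{C}$ packs if $\mathrm{pn}=\mathrm{bn}$. Contraction $\mathcal{C}/A$ = minimal members of $\{X\setminus A:X\in\mathcal{C}\}$; deletion $\mathcal{C}\setminus A=\{X\in\mathcal{C}:X\cap A=\emptyset\}$; minors arise by iterating these; $\mathcal{C}$ is minimally non-packing if it does not pack but every proper minor packs. $\mathcal{C}$ is ideal if $\{x\ge0:\langle x,1_H\rangle\ge1\ \forall H\in\mathcal{C}\}$ is an integral polyhedron. A fractional packing is $y:\mathcal{C}\to\mathbb{R}_{\ge0}$ with $\sum_{H\ni a}y(H)\le1$ for all $a$; $\mathrm{fpn}(\mathcal{C})$ is the maximum of $\sum_H y(H)$; the integral blocking condition is $\mathrm{fpn}(\mathcal{C})=\mathrm{bn}(\mathcal{C})$. $\tilde{\mathcal{C}}=\{H\in\mathcal{C}:|H\cap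 B|=1\ \forall B\in\mathrm{minb}(\mathcal{C})\}$. $\mathrm{I}(\mathcal{C})=\{x\in\mathbb{R}^E:\langle x,1_D\rangle=1\ \forall D\in\mathrm{minb}(\mathcal{C}),\ \langle x,1_D\rangle\ge1\ \forall D\in\mathrm{b}(\mathcal{C}),\ x\ge0\}$. With $\mathcal{C}[F]=\{X\in\mathcal{C}:X\subseteq F\}$, $\mathcal{C}$ is separable if some partition $\{E_1,E_2\}$ of $E$ into nonempty parts has $\mathrm{bn}(\mathcal{C})=\mathrm{bn}(\mathcal{C}[E_1])+\mathrm{bn}(\mathcal{C}[E_2])$, non-separable otherwise. *)

(* Defs.v *)
From HB Require Import structures.
From mathcomp Require Import all_boot all_order all_algebra.
From mathcomp Require Import archimedean.
From mathcomp Require Import reals.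

Set Implicit Arguments.
Unset Strict Implicit.
Unset Printing Implicit Defensive.

Import Order.TTheory GRing.Theory Num.Theory.

Local Open Scope ring_scope.

Section Combinatorics.
Variable E : finType.
Implicit Types (C : {set {set E}}) (A B F G H X : {set E}).

Definition clutter C : Prop :=
  forall X Y, X \in C -> Y \in C -> X \subset Y -> X = Y.

Definition meets_all C : pred {set E} :=
  fun B => [forall H in C, H :&: B != set0].

Definition transversals C : {set {set E}} := [set B | minset (meets_all C) B].

(* There is no transversal iff [set0 \in C] (for a clutter, iff
   [C = [set set0]]); only then is the value [#|E|] a placeholder, for the
   conventional blocking number +oo. *)
Definition bn C : nat := \big[minn/#|E|]_(B in transversals C) #|B|.

Definition minb C : {set {set E}} := [set B in transversals C | #|B| == bn C].

Definition pn C : nat :=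
  \max_(S : {set {set E}} | (S \subset C) && trivIset S) #|S|.

(* The clutter [[set set0]] packs by convention: it has no transversal, and
   its hyperedge is disjoint from itself, so both numbers count as +oo. *)
Definition packs C : bool := (set0 \in C) || (pn C == bn C).

Definition minimal_members C : {set {set E}} :=
  [set X | minset [in C] X].

Definition contraction C A : {set {set E}} :=
  minimal_members [set X :\: A | X in C].

Definition deletion C A : {set {set E}} :=
  [set X in C | X :&: A == set0].

(* [minor G C G' C']: the clutter [C'] on the ground set [G'] is a minor of the
   clutter [C] on the ground set [G].  The ground set is tracked because
   removing an element contained in no hyperedge gives a proper minor with the
   same hyperedges.  [bn] and [pn] depend only on the hyperedges: transversals
   lie in the union of the hyperedges. *)
Inductive minor G C : {set E} -> {set {set E}} -> Prop :=
| MinorRefl : minor G C G C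
| MinorContraction G' C' A of minor G C G' C' & A \subset G' :
    minor G C (G' :\: A) (contraction C' A)
| MinorDeletion G' C' A of minor G C G' C' & A \subset G' :
    minor G C (G' :\: A) (deletion C' A).

Definition minimally_non_packing C : Prop :=
  ~~ packs C /\
  (forall G' C', minor [set: E] C G' C' -> G' \proper [set: E] -> packs C').

Definition tilde C : {set {set E}} :=
  [set H in C | [forall B in minb C, #|H :&: B| == 1%N]].

Definition restriction C F : {set {set E}} := [set X in C | X \subset F].

Definition separable C : Prop :=
  exists E1 E2 : {set E},
    [/\ E1 != set0, E2 != set0, E1 :&: E2 = set0, E1 :|: E2 = [set: E] &
        bn C = (bn (restriction C E1) + bn (restriction C E2))%N].

End Combinatorics.

Section Polyhedra.
Variables (R : realType) (E : finType).
Implicit Types (C : {set {set E}}) (x : {ffun E -> R}).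
Implicit Types (P S : {ffun E -> R} -> Prop).

Definition dot (x y : {ffun E -> R}) : R := \sum_(e : E) x e * y e.

Definition indic (H : {set E}) : {ffun E -> R} := [ffun e => (e \in H)%:R].

Definition conv_hull S : {ffun E -> R} -> Prop := fun x =>
  exists (n : nat) (p : 'I_n -> {ffun E -> R}) (w : 'I_n -> R),
    [/\ forall i, S (p i), forall i, 0 <= w i, \sum_(i < n) w i = 1 &
        forall e, x e = \sum_(i < n) w i * p i e].

Definition lattice : {ffun E -> R} -> Prop :=
  fun x => forall e, x e \is a Num.int.

(* A polyhedron is integral if it is its own integer hull.  For
   rational polyhedra contained in the nonnegative orthant, such as those
   below, this says that all vertices are lattice points. *)
Definition integral P : Prop :=
  forall x, P x <-> conv_hull (fun z => P z /\ lattice z) x.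

Definition polytope P : Prop :=
  exists s : seq {ffun E -> R},
    forall x, P x <-> conv_hull (fun z => z \in s) x.

Definition integral_polytope P : Prop := polytope P /\ integral P.

Definition covering_polyhedron C : {ffun E -> R} -> Prop := fun x =>
  (forall e, 0 <= x e) /\ (forall H, H \in C -> 1 <= dot x (indic H)).

Definition ideal C : Prop := integral (covering_polyhedron C).

(* Only the values of [y] on [C] are relevant. *)
Definition fractional_packing C (y : {set E} -> R) : Prop :=
  (forall H, H \in C -> 0 <= y H) /\
  (forall a : E, \sum_(H in C | a \in H) y H <= 1).

(* [is_fpn C v]: the maximum defining fpn(C) exists and equals [v]. *)
Definition is_fpn C (v : R) : Prop :=
  (exists y, fractional_packing C y /\ \sum_(H in C) y H = v) /\
  (forall y, fractional_packing C y -> \sum_(H in C) y H <= v).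

Definition integral_blocking_condition C : Prop := is_fpn C (bn C)%:R.

Definition I_polyhedron C : {ffun E -> R} -> Prop := fun x =>
  [/\ forall D, D \in minb C -> dot x (indic D) = 1,
      forall D, D \in transversals C -> 1 <= dot x (indic D) &
      forall e, 0 <= x e].

End Polyhedra.

Arguments ideal R {E} C.
Arguments integral_blocking_condition R {E} C.
Arguments I_polyhedron R {E} C.

(* Main.v *)
(* Let [D] be ideal and minimally non-packing, [C = tilde D] and
   [t = bn D > pn D].  By Farkas' lemma and ideality, every point of
   [I_polyhedron D] dominates a convex combination of members of [D], and by
   complementary slackness these members lie in [C].
   - The constant vector [1/t] lies in [I_polyhedron D]; scaling its
     combination by [t] gives a fractional packing of [C] of value [t], so
     [fpn C = bn C = t].
   - Since [bn C = bn D], we have [I_polyhedron C <= I_polyhedron D].  Every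
     element [e] lies in a minimum transversal of [D]: otherwise deleting [e]
     keeps the blocking number [t], and as that minor packs, so would [D].
     Hence the domination above is an equality, and [I_polyhedron C] is the
     convex hull of the members of [tilde C].
   - If [E1, E2] separated [C], the proper minors [D[E1]] and [D[E2]] would
     pack, and the union of their packings would have at least [t] members. *)
Require Import Defs.
From mathcomp Require Import all_boot all_order all_algebra.
From mathcomp Require Import reals.
From mathcomp Require Import boolp archimedean ring.

Set Implicit Arguments.
Unset Strict Implicit.
Unset Printing Implicit Defensive.

Import Order.TTheory GRing.Theory Num.Theory.

Local Open Scope ring_scope.

(** * Farkas' lemma *)

Lemma dotC (R : realType) (V : finType) (f g : {ffun V -> R}) :
  dot f g = dot g f.
Proof. by apply: eq_bigr => v _; rewrite mulrC. Qed.

Lemma dotBl (R : realType) (V : finType) (f g z : {ffun V -> R}) (c : R) :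
  dot [ffun v => f v - c * g v] z = dot f z - c * dot g z.
Proof.
rewrite /dot mulr_sumr -sumrB; apply: eq_bigr => v _.
by rewrite ffunE mulrBl mulrA.
Qed.

Lemma dotBr (R : realType) (V : finType) (f g z : {ffun V -> R}) (c : R) :
  dot z [ffun v => f v - c * g v] = dot z f - c * dot z g.
Proof. by rewrite dotC dotBl !(dotC z). Qed.

(** Induction on the generators: either those in the tail already force [0 <= dot b z], or some [z0]
    violates this and [a i] is projected away. Since [s] has no duplicates, setting the coefficient
    at [i] leaves those of the tail alone. *)
Lemma farkas (R : realType) (V : finType) (I : eqType) (s : seq I)
    (a : I -> {ffun V -> R}) (b : {ffun V -> R}) :
  uniq s ->
  (forall z, (forall i, i \in s -> 0 <= dot (a i) z) -> 0 <= dot b z) ->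
  exists l : I -> R, (forall i, 0 <= l i) /\
    (forall v, b v = \sum_(i <- s) l i * a i v).
Proof.
elim: s a b => [|i s IH] a b.
  move=> _ Hb; exists (fun=> 0); split=> // v; rewrite big_nil.
  (* Without generators, testing at [- b] forces [b = 0]. *)
  have /Hb : forall i : I, i \in [::] -> 0 <= dot (a i) [ffun v => - b v] by [].
  have -> : dot b [ffun v => - b v] = - \sum_v b v ^+ 2.
    rewrite /dot -sumrN; apply: eq_bigr => w _.
    by rewrite ffunE mulrN.
  rewrite oppr_ge0 => sb.
  have s0 : \sum_v b v ^+ 2 = 0.
    by apply/eqP; rewrite eq_le sb sumr_ge0 // => w _; rewrite sqr_ge0.
  have /(_ v isT) /eqP := psumr_eq0P (fun w _ => sqr_ge0 (b w)) s0.
  by rewrite sqrf_eq0 => /eqP.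
move=> /= /andP[nis us] Hb.
have [Hs|] := pselect (forall z, (forall j, j \in s -> 0 <= dot (a j) z) ->
    0 <= dot b z).
  have [l [l0 lE]] := IH a b us Hs.
  exists (fun j => if j == i then 0 else l j); split=> [j|v].
    by case: ifP.
  rewrite big_cons eqxx mul0r add0r lE; apply: eq_big_seq => j js.
  by case: eqP => // ji; rewrite -ji js in nis.
move=> /existsNP[z0 /not_implyP[z0s /negP]]; rewrite -ltNge => bz0.
(* Otherwise [z0] would satisfy every constraint in [Hb]. *)
have az0 : dot (a i) z0 < 0.
  rewrite ltNge; apply/negP => az0; move: bz0; rewrite ltNge Hb //.
  by move=> j; rewrite inE => /orP[/eqP->|/z0s].
set c := dot (a i) z0 in az0.
have c0 : c != 0 by rewrite lt_eqF.
(* Pullback along the projection [z |-> z - (a i z / c) z0] onto the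
   hyperplane [a i = 0]. *)
pose pr (f : {ffun V -> R}) : {ffun V -> R} :=
  [ffun v => f v - dot f z0 / c * a i v].
have prE f z : dot (pr f) z = dot f [ffun v => z v - dot (a i) z / c * z0 v].
  by rewrite dotBl dotBr; field.
have [z Hz|l [l0 lE]] := IH (fun j => pr (a j)) (pr b) us.
  rewrite prE; apply: Hb => j; rewrite inE => /orP[/eqP->|js]; last first.
    by rewrite -prE Hz.
  rewrite -prE (_ : pr _ = [ffun=> 0]).
    by rewrite /dot sumr_ge0 // => v _; rewrite ffunE mul0r.
  by apply/ffunP => v; rewrite !ffunE -/c divff // mul1r subrr.
(* The coefficient of [a i] once [lE] is expanded; it is nonnegative because [c] and [dot b z0] are
   negative and each [dot (a j) z0] is nonnegative. *)
pose m := dot b z0 / c - \sum_(j <- s) l j * (dot (a j) z0 / c).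
exists (fun j => if j == i then m else l j); split=> [j|v].
  case: ifP => // _; rewrite /m -sumrN addr_ge0 //.
    by rewrite nmulr_lge0 ?invr_lt0 // ltW.
  rewrite big_seq sumr_ge0 // => k ks; rewrite -mulrN mulr_ge0 //.
  by rewrite -mulrN mulr_ge0 ?z0s // oppr_ge0 invr_le0 ltW.
rewrite big_cons eqxx.
under eq_big_seq => j js.
  rewrite (_ : (if _ then _ else _) = l j); last first.
    by case: eqP => // ji; rewrite -ji js in nis.
  over.
have := lE v; rewrite ffunE => /eqP; rewrite subr_eq => /eqP ->.
have -> : \sum_(j <- s) l j * pr (a j) v = \sum_(j <- s) l j * a j v
    - (\sum_(j <- s) l j * (dot (a j) z0 / c)) * a i v.
  rewrite mulr_suml -sumrB; apply: eq_bigr => j _.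
  by rewrite ffunE mulrBr !mulrA.
by rewrite /m; ring.
Qed.

(** * Blocking and packing numbers *)

Section Combinatorics.
Variable E : finType.
Implicit Types (C D S : {set {set E}}) (B F H : {set E}).

Lemma meets_allP C B :
  reflect (forall H, H \in C -> H :&: B != set0) (meets_all C B).
Proof. exact: forall_inP. Qed.

Lemma meets_all_subset C D B : C \subset D -> meets_all D B -> meets_all C B.
Proof. by move=> /subsetP CD /meets_allP DB; apply/meets_allP=> H /CD/DB. Qed.

Lemma transversal_meets_all C B : B \in transversals C -> meets_all C B.
Proof. by rewrite inE => /minsetp. Qed.

Lemma transversal_below C B :
  meets_all C B -> exists2 B', B' \in transversals C & B' \subset B.
Proof. by move=> /minset_exists[B' mB' sB']; exists B'; rewrite ?inE. Qed.

Lemma bn_le_transversal C B : B \in transversals C -> (bn C <= #|B|)%N.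
Proof.
move=> BC; rewrite /bn; have := mem_index_enum B.
elim: (index_enum _) => [|B' s IH]; first by rewrite in_nil.
rewrite inE big_cons => /orP[/eqP<-|/IH sB]; first by rewrite BC geq_minl.
by case: ifP => // _; rewrite geq_min sB orbT.
Qed.

Lemma bn_le C B : meets_all C B -> (bn C <= #|B|)%N.
Proof.
move=> /transversal_below[B' /bn_le_transversal B'C sB].
by apply: leq_trans B'C (subset_leq_card sB).
Qed.

(** Minimality is automatic at size [bn C]: a proper subset still meeting every hyperedge would have
    fewer than [bn C] elements. *)
Lemma minbP C B : reflect (meets_all C B /\ #|B| = bn C) (B \in minb C).
Proof.
apply: (iffP idP) => [|[CB cB]].
  by rewrite inE => /andP[/transversal_meets_all ? /eqP].
rewrite inE cB eqxx andbT inE; apply/minsetP; split=> // B' CB' sB'.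
by apply/eqP; rewrite eqEcard sB' cB bn_le.
Qed.

Lemma minb_exists C : set0 \notin C -> exists B, B \in minb C.
Proof.
move=> C0; have CT : meets_all C setT.
  by apply/meets_allP=> H HC; rewrite setIT; apply: contraNneq C0 => <-.
have [B [BC cB]] : exists B, meets_all C B /\ (#|B| = bn C)%N.
  (* Being the size of a set that meets every hyperedge is preserved by minima; [setT] realizes the
     placeholder [#|E|]. *)
  rewrite /bn; elim/big_ind: _ => [|m n [B mB] [B' nB']|B /transversal_meets_all].
  - by exists setT; rewrite cardsT.
  - by case: (leqP m n) => _; [exists B | exists B'].
  - by exists B.
by exists B; apply/minbP.
Qed.

Lemma bn_subset C D : set0 \notin D -> C \subset D -> (bn C <= bn D)%N.
Proof.
move=> /minb_exists[B /minbP[DB <-]] CD.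
by apply: bn_le; apply: meets_all_subset CD DB.
Qed.

Lemma trivIset_setI S H H' x :
  trivIset S -> H \in S -> H' \in S -> x \in H -> x \in H' -> H = H'.
Proof.
move=> tS HS HS' xH xH'; apply: contraTeq tS => HH'.
apply/negP => /trivIsetP/(_ _ _ HS HS' HH')/pred0P/(_ x) /=.
by rewrite xH xH'.
Qed.

Lemma pn_ge C S : S \subset C -> trivIset S -> (#|S| <= pn C)%N.
Proof.
by move=> SC tS; rewrite /pn (bigD1 S) /= ?SC // leq_maxl.
Qed.

Lemma pn_witness C : exists S, [/\ S \subset C, trivIset S & #|S| = pn C].
Proof.
rewrite /pn; elim/big_ind: _ => [|m n [S mS] [S' nS']|S /andP[]].
- by exists set0; rewrite sub0set cards0; split=> //; apply/trivIsetP=> ? ?; rewrite inE.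
- by case: (leqP m n) => _; [exists S' | exists S].
- by exists S.
Qed.

(** Picking a point of [H :&: B] in each member [H] of a maximum packing is injective, the members
    being disjoint. *)
Lemma pn_le C B : meets_all C B -> (pn C <= #|B|)%N.
Proof.
move=> /meets_allP CB; have [S [/subsetP SC tS <-]] := pn_witness C.
pose f H := [pick e in H :&: B].
have fE H : H \in S -> exists e, [/\ f H = Some e, e \in H & e \in B].
  rewrite /f; case: pickP => [e|H0 /SC/CB/set0Pn[e]]; last by rewrite H0.
  by rewrite inE => /andP[eH eB] _; exists e.
rewrite -(card_in_imset (f := f)) => [|H H' HS H'S].
  rewrite -(card_imset (mem B) (@Some_inj _)); apply/subset_leq_card/subsetP.
  by move=> _ /imsetP[H /fE[e [-> _ eB]] ->]; exact: imset_f.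
have [e [-> eH _]] := fE H HS; have [e' [-> eH' _]] := fE H' H'S.
by move=> [ee]; apply: trivIset_setI tS HS H'S eH _; rewrite ee.
Qed.

Lemma pn_le_bn C : set0 \notin C -> (pn C <= bn C)%N.
Proof. by move=> /minb_exists[B /minbP[/pn_le + <-]]. Qed.

Lemma not_packsP C : ~~ packs C -> set0 \notin C /\ (pn C < bn C)%N.
Proof.
rewrite /packs negb_or => /andP[C0 pb]; split=> //.
by rewrite ltn_neqAle pb pn_le_bn.
Qed.

Lemma packs_pn C : set0 \notin C -> packs C -> pn C = bn C.
Proof. by rewrite /packs => /negPf-> /= /eqP. Qed.

(** * Restrictions and minimally non-packing clutters *)

Lemma tilde_sub C : tilde C \subset C.
Proof. by apply/subsetP => H; rewrite inE => /andP[]. Qed.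

Lemma tilde_set0 C : set0 \notin C -> set0 \notin tilde C.
Proof. by apply: contraNN; apply/subsetP/tilde_sub. Qed.

(** Turns the restrictions occurring in separability into minors. *)
Lemma restriction_deletion C F : restriction C F = deletion C (~: F).
Proof.
by apply/setP=> H; rewrite !inE setI_eq0 disjoints_subset setCK.
Qed.

Lemma restriction_sub C F : restriction C F \subset C.
Proof. by apply/subsetP=> H; rewrite inE => /andP[]. Qed.

Lemma restriction_set0 C F : set0 \notin C -> set0 \notin restriction C F.
Proof. by apply: contraNN; apply/subsetP/restriction_sub. Qed.

Lemma minimally_non_packing_restriction D F :
  minimally_non_packing D -> F != setT -> packs (restriction D F).
Proof.
move=> [_ Dmin] FT; rewrite restriction_deletion.
apply: (Dmin ([set: E] :\: ~: F)); first exact: MinorDeletion (MinorRefl _ _) _.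
by rewrite setTD setCK properT.
Qed.

(** Deleting [e] gives a minor that packs, so its blocking number is at most [pn D], hence below
    [bn D]; adding [e] to one of its minimum transversals yields the required set. *)
Lemma minimally_non_packing_minb_cover D (e : E) :
  minimally_non_packing D -> exists2 B, B \in minb D & e \in B.
Proof.
move=> Dmnp; have [D0 pbD] := not_packsP Dmnp.1.
set F := [set~ e]; have FT : F != setT.
  by apply/eqP => /setP/(_ e); rewrite !inE eqxx.
have De0 := restriction_set0 F D0.
have pbe := packs_pn De0 (minimally_non_packing_restriction Dmnp FT).
have bnlt : (bn (restriction D F) < bn D)%N.
  rewrite -pbe; apply: leq_ltn_trans pbD.
  have [S [SD tS <-]] := pn_witness (restriction D F).
  by apply: pn_ge tS; apply: subset_trans SD (restriction_sub _ _).
have [B' /minbP[B'D cB']] := minb_exists De0.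
have eB : meets_all D (e |: B').
  apply/meets_allP => H HD; have [eH|eH] := boolP (e \in H).
    by apply/set0Pn; exists e; rewrite !inE eH eqxx.
  have /set0Pn[e' /setIP[e'H e'B]] : H :&: B' != set0.
    apply: (meets_allP _ _ B'D); rewrite inE HD.
    by apply/subsetP => e' e'H; rewrite !inE; apply: contraNneq eH => <-.
  by apply/set0Pn; exists e'; rewrite !inE e'H e'B orbT.
exists (e |: B'); last by rewrite !inE eqxx.
apply/minbP; split=> //; apply/eqP; rewrite eqn_leq bn_le // andbT.
by apply: leq_trans bnlt; rewrite -cB' cardsU1; case: (_ \in _).
Qed.

Lemma minimally_non_packing_non_separable C D :
  minimally_non_packing D -> C \subset D -> bn C = bn D -> ~ separable C.
Proof.
move=> Dmnp CD bnE [E1 [E2 [E1n E2n E12 E12T bnC]]].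
have [D0 pbD] := not_packsP Dmnp.1.
have E1T : E1 != setT by apply: contraNneq E2n => E1T; rewrite -E12 E1T setTI.
have E2T : E2 != setT by apply: contraNneq E1n => E2T; rewrite -E12 E2T setIT.
(* A maximum packing of [D[F]] works: its size is the blocking number of [D[F]], which contains
   [C[F]]. *)
have pack F : F != setT -> exists S,
    [/\ S \subset restriction D F, trivIset S & (bn (restriction C F) <= #|S|)%N].
  move=> FT; have DF0 := restriction_set0 F D0.
  have [S [SD tS cS]] := pn_witness (restriction D F).
  exists S; split=> //; rewrite cS.
  rewrite (packs_pn DF0) ?minimally_non_packing_restriction //.
  apply: bn_subset DF0 _; apply/subsetP => H; rewrite !inE => /andP[HC ->].
  by rewrite (subsetP CD).
have [S1 [/subsetP S1D tS1 cS1]] := pack _ E1T.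
have [S2 [/subsetP S2D tS2 cS2]] := pack _ E2T.
have disj H H' : H \in S1 -> H' \in S2 -> [disjoint H & H'].
  move=> /S1D; rewrite inE => /andP[_ HE1] /S2D; rewrite inE => /andP[_ HE2].
  by rewrite -setI_eq0 -subset0 -E12 setISS.
(* A common member would be disjoint from itself, hence empty. *)
have S12 : [disjoint S1 & S2].
  apply/pred0P => H /=; apply/negP => /andP[H1 H2].
  have := disj _ _ H1 H2; rewrite -setI_eq0 setIid => /eqP H0.
  by move/S1D: H1; rewrite H0 (negPf (restriction_set0 E1 D0)).
have tS : trivIset (S1 :|: S2).
  apply/trivIsetP => H H' /setUP[] HS /setUP[] H'S HH'.
  - exact: (trivIsetP tS1).
  - exact: disj.
  - by rewrite disjoint_sym disj.
  - exact: (trivIsetP tS2).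
have /pn_ge/(_ tS) : S1 :|: S2 \subset D.
  by apply/subsetP=> H /setUP[/S1D|/S2D]; apply/subsetP/restriction_sub.
rewrite cardsU (disjoint_setI0 S12) cards0 subn0 leqNgt.
by rewrite (leq_trans pbD) // -bnE bnC leq_add.
Qed.

End Combinatorics.

(** * Packing duality and the blocker of an ideal clutter *)

Section Duality.
Variables (R : realType) (E : finType).
Implicit Types (C D : {set {set E}}) (B H : {set E}) (x : {ffun E -> R}).
Implicit Types (y : {set E} -> R).

Lemma dot_indic x B : dot x (indic R B) = \sum_(e in B) x e.
Proof.
rewrite /dot [RHS]big_mkcond /=; apply: eq_bigr => e _; rewrite ffunE.
by case: ifP; rewrite ?mulr1 ?mulr0.
Qed.

Lemma dot_indic2 H B : dot (indic R H) (indic R B) = #|H :&: B|%:R.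
Proof.
rewrite dot_indic -sum1_card natr_sum [RHS]big_mkcond [LHS]big_mkcond /=.
apply: eq_bigr => e _; rewrite ffunE !inE.
by case: (e \in H); case: (e \in B).
Qed.

(** Double counting of the incidences [e \in H :&: B], weighted by [y H]. *)
Lemma sum_incidence C y B :
  \sum_(e in B) \sum_(H in C | e \in H) y H
    = \sum_(H in C) y H * #|H :&: B|%:R.
Proof.
rewrite (exchange_big_dep [in C]) /=; last by move=> e H _ /andP[].
apply: eq_bigr => H HC; rewrite HC /= -sum1_card natr_sum mulr_sumr.
by apply: eq_big => [e|e _]; rewrite ?inE 1?andbC ?mulr1.
Qed.

Lemma meets_all_card_ge1 C B H :
  meets_all C B -> H \in C -> 1 <= #|H :&: B|%:R :> R.
Proof. by move=> /meets_allP CB /CB; rewrite -card_gt0 ler1n. Qed.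

Lemma weak_duality C y B :
  fractional_packing C y -> meets_all C B -> \sum_(H in C) y H <= #|B|%:R.
Proof.
move=> [y0 y1] CB.
apply: (@le_trans _ _ (\sum_(H in C) y H * #|H :&: B|%:R)).
  apply: ler_sum => H HC.
  by rewrite ler_peMr ?y0 // (meets_all_card_ge1 CB).
rewrite -sum_incidence -sum1_card natr_sum.
by apply: ler_sum => e _.
Qed.

(** Complementary slackness: the terms [y H * (#|H :&: B| - 1)] are nonnegative with sum at most 0,
    so each vanishes. *)
Lemma tight_card1 C y B :
  (forall H, H \in C -> 0 <= y H) -> meets_all C B ->
  \sum_(H in C) y H * #|H :&: B|%:R <= \sum_(H in C) y H ->
  forall H, H \in C -> y H != 0 -> #|H :&: B| = 1%N.
Proof.
move=> y0 CB le H HC yH.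
have z0 H' : H' \in C -> 0 <= y H' * #|H' :&: B|%:R - y H'.
  by move=> H'C; rewrite subr_ge0 ler_peMr ?y0 // (meets_all_card_ge1 CB).
have s0 : \sum_(H' in C) (y H' * #|H' :&: B|%:R - y H') = 0.
  apply/eqP; rewrite eq_le sumr_ge0 // andbT.
  by rewrite sumrB subr_le0.
have /eqP := psumr_eq0P z0 s0 HC.
rewrite -{2}[y H]mulr1 -mulrBr mulf_eq0 (negPf yH) /= subr_eq0.
by rewrite pnatr_eq1 => /eqP.
Qed.

(** The support of [p] meets every hyperedge, so it contains a transversal [B]; by integrality [p]
    is at least 1 on [B], and [dot x p] is at least [x(B)]. *)
Lemma covering_lattice_dot D x p :
  (forall e, 0 <= x e) ->
  (forall B, B \in transversals D -> 1 <= dot x (indic R B)) ->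
  covering_polyhedron D p -> lattice p -> 1 <= dot x p.
Proof.
move=> x0 x1 [p0 pD] pZ.
have pge1 e : p e != 0 -> 1 <= p e.
  move=> pe; have /intrP[k kE] := pZ e.
  move: (p0 e) pe; rewrite kE ler0z intr_eq0 => k0 kn0.
  by rewrite ler1z -gtz0_ge1 lt_neqAle eq_sym kn0.
have pB : meets_all D [set e | p e != 0].
  apply/meets_allP => H HD; apply/eqP => H0.
  have := pD H HD; rewrite dot_indic big1 ?ler10 // => e eH.
  apply/eqP; apply/negPn/negP => pe.
  by move/setP: H0 => /(_ e); rewrite !inE eH pe.
have [B BD /subsetP sB] := transversal_below pB.
apply: (le_trans (x1 B BD)); rewrite dot_indic /dot big_mkcond /=.
apply: ler_sum => e _; case: ifP => [/sB|_]; last by rewrite mulr_ge0.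
by rewrite inE => pe; rewrite ler_peMr ?pge1.
Qed.

(* Lehman's theorem that the blocker of an ideal clutter is ideal. *)
Lemma ideal_blocker D x :
  ideal R D -> (forall e, 0 <= x e) ->
  (forall B, B \in transversals D -> 1 <= dot x (indic R B)) ->
  exists y, [/\ forall H, 0 <= y H, \sum_(H in D) y H = 1 &
    forall e, \sum_(H in D | e \in H) y H <= x e].
Proof.
move=> Did x0 x1.
have sumo (f g : {ffun option E -> R}) :
    dot f g = f None * g None + \sum_e f (Some e) * g (Some e).
  rewrite /dot (bigD1 None) //= (reindex_omap Some id) => [|[]//].
  by congr (_ + _); apply: eq_bigl => e; rewrite /= eqxx.
(* The coordinate [None] carries the normalization [\sum y = 1]. *)
pose a (i : {set E} + E) : {ffun option E -> R} := [ffun o =>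
  match i, o with
  | inl H, Some e => (e \in H)%:R
  | inl H, None => -1
  | inr e', Some e => (e == e')%:R
  | inr e', None => 0
  end].
(* In a conic representation of [b], the weights on [inl H] form [y] and the weight on [inr e] is
   the slack at [e]. *)
pose b : {ffun option E -> R} := [ffun o => if o is Some e then x e else -1].
pose s := [seq inl H | H <- enum D] ++ [seq inr e | e <- enum E] : seq ({set E} + E).
have us : uniq s.
  have inlI : injective (@inl {set E} E) by move=> ? ? [].
  have inrI : injective (@inr {set E} E) by move=> ? ? [].
  rewrite cat_uniq (map_inj_uniq inlI) (map_inj_uniq inrI) !enum_uniq andbT /=.
  by apply/hasPn => i /mapP[e _ ->]; apply/mapP => -[].
have [z Hz|l [l0 lE]] := farkas us (a := a) (b := b).
  pose z' : {ffun E -> R} := [ffun e => z (Some e)].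
  have bz : dot b z = dot x z' - z None.
    rewrite sumo ffunE mulN1r addrC; congr (_ - _).
    by apply: eq_bigr => e _; rewrite !ffunE.
  have z'0 e : 0 <= z' e.
    have := Hz (inr e); rewrite mem_cat map_f ?mem_enum ?orbT // => /(_ isT).
    rewrite sumo ffunE mul0r add0r (bigD1 e) //= big1 ?addr0.
      by rewrite !ffunE eqxx mul1r.
    by move=> e' /negPf ee'; rewrite !ffunE ee' mul0r.
  have z'H H : H \in D -> z None <= dot z' (indic R H).
    move=> HD; have := Hz (inl H); rewrite mem_cat map_f ?mem_enum // => /(_ isT).
    rewrite sumo ffunE mulN1r addrC subr_ge0 => /le_trans; apply.
    by apply: ler_sum => e _; rewrite !ffunE mulrC.
  rewrite bz subr_ge0; have [w0|w0] := leP (z None) 0.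
    by apply: le_trans w0 _; apply: sumr_ge0 => e _; rewrite mulr_ge0.
  set w := z None in z'H w0 *.
  (* Ideality makes the rescaled point a convex combination of lattice points of the polyhedron,
     each having product at least 1 with [x]. *)
  have : covering_polyhedron D [ffun e => z' e / w].
    split=> [e|H HD]; first by rewrite ffunE divr_ge0 ?z'0 ?(ltW w0).
    have -> : dot [ffun e => z' e / w] (indic R H) = dot z' (indic R H) / w.
      by rewrite !dot_indic mulr_suml; apply: eq_bigr => e _; rewrite ffunE.
    by rewrite ler_pdivlMr // mul1r z'H.
  move=> /Did[n [p [c [pP c0 c1 pE]]]].
  rewrite -[w]mul1r -ler_pdivlMr //.
  have -> : dot x z' / w = \sum_(i < n) c i * dot x (p i).
    rewrite /dot mulr_suml; under [RHS]eq_bigr do rewrite mulr_sumr.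
    rewrite exchange_big; apply: eq_bigr => e _ /=.
    have := pE e; rewrite ffunE -mulrA => ->; rewrite mulr_sumr.
    by apply: eq_bigr => i _; ring.
  rewrite -c1; apply: ler_sum => i _; rewrite ler_peMr //.
  by have [pi1 pi2] := pP i; exact: covering_lattice_dot x1 pi1 pi2.
(* Coordinate [None] gives total weight 1; coordinate [Some e] gives the domination once the slack
   is dropped. *)
exists (fun H => l (inl H)); split=> // [|e].
  have := lE None; rewrite ffunE big_cat !big_map /= !big_enum /=.
  under eq_bigr do rewrite ffunE mulrN1.
  under [X in _ + X]eq_bigr do rewrite ffunE mulr0.
  by rewrite big1_eq addr0 sumrN => /oppr_inj.
have := lE (Some e); rewrite ffunE big_cat !big_map /= !big_enum /= => ->.
rewrite -[leLHS]addr0 lerD //; last first.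
  by apply: sumr_ge0 => e' _; rewrite ffunE mulr_ge0.
rewrite big_mkcondr; apply: ler_sum => H _; rewrite ffunE.
by case: ifP; rewrite ?mulr1 ?mulr0.
Qed.

(** * The polyhedron [I_polyhedron] and the clutter [tilde D] *)

Lemma I_polyhedron_dominates D x :
  ideal R D -> I_polyhedron R D x ->
  exists y, [/\ forall H, 0 <= y H, \sum_(H in tilde D) y H = 1 &
    forall e, \sum_(H in tilde D | e \in H) y H <= x e].
Proof.
move=> Did [xmin x1 x0].
have [y [y0 ys yx]] := ideal_blocker Did x0 x1.
(* The load on a minimum transversal [B] is at most [x(B) = 1], the total weight, so complementary
   slackness applies. *)
have supp H : H \in D -> H \notin tilde D -> y H = 0.
  move=> HD; rewrite inE HD /= => /forall_inPn[B Bmin]; apply: contraNeq => yH.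
  apply/eqP; apply: (tight_card1 (C := D) (y := y)) => //.
    by have [] := minbP _ _ Bmin.
  rewrite -sum_incidence ys -(xmin B Bmin) dot_indic.
  by apply: ler_sum => e _; exact: yx.
have tD H : H \in tilde D -> H \in D by apply/subsetP/tilde_sub.
have sumE (P : pred {set E}) :
    \sum_(H in tilde D | P H) y H = \sum_(H in D | P H) y H.
  rewrite [RHS](bigID [in tilde D]) /= [X in _ + X]big1 ?addr0.
    apply: eq_bigl => H; apply/idP/idP => [/andP[HD ->]|]; first by rewrite HD tD.
    by case/andP => /andP[_ ->] ->.
  by move=> H /andP[/andP[HD _]]; apply: supp.
exists y; split=> [//||e]; last by rewrite sumE.
have := sumE predT; under eq_bigl do rewrite andbT.
by under [RHS]eq_bigl do rewrite andbT; move=> ->.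
Qed.

Lemma conv_hull_enum (K : {set {set E}}) (P : {ffun E -> R} -> Prop) y x :
  (forall H, 0 <= y H) -> \sum_(H in K) y H = 1 ->
  (forall H, H \in K -> P (indic R H)) ->
  (forall e, x e = \sum_(H in K) y H * (e \in H)%:R) -> conv_hull P x.
Proof.
move=> y0 y1 KP xE.
exists #|K|, (fun i => indic R (enum_val i)), (fun i => y (enum_val i)).
split=> [i|//||e]; first exact/KP/enum_valP.
  by rewrite -y1 [in RHS]big_enum_val.
by rewrite xE [in LHS]big_enum_val /=; apply: eq_bigr => i _; rewrite ffunE.
Qed.

Lemma conv_hull_mono (P Q : {ffun E -> R} -> Prop) x :
  (forall z, P z -> Q z) -> conv_hull P x -> conv_hull Q x.
Proof.
by move=> PQ [n [p [w [pP w0 w1 xE]]]]; exists n, p, w; split=> // i; apply: PQ.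
Qed.

Lemma I_polyhedron_convex C x :
  conv_hull (I_polyhedron R C) x -> I_polyhedron R C x.
Proof.
move=> [n [p [w [pI w0 w1 xE]]]].
have dotE B : dot x (indic R B) = \sum_(i < n) w i * dot (p i) (indic R B).
  rewrite dot_indic; under eq_bigr do rewrite xE.
  by rewrite exchange_big; apply: eq_bigr => i _; rewrite dot_indic mulr_sumr.
split=> [B Bm|B Bt|e].
- rewrite dotE -w1; apply: eq_bigr => i _.
  by have [-> //] := pI i; rewrite mulr1.
- rewrite dotE -w1; apply: ler_sum => i _.
  by have [_ pB _] := pI i; rewrite ler_peMr ?pB.
- by rewrite xE sumr_ge0 // => i _; have [_ _ p0] := pI i; rewrite mulr_ge0.
Qed.

Lemma indic_in_I C H : H \in tilde C -> I_polyhedron R C (indic R H).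
Proof.
rewrite inE => /andP[HC /forall_inP H1]; split=> [B /H1/eqP e|B Bt|e].
- by rewrite dot_indic2 e.
- by rewrite dot_indic2 (meets_all_card_ge1 (transversal_meets_all Bt)).
- by rewrite ffunE.
Qed.

Lemma indic_lattice H : lattice (indic R H).
Proof. by move=> e; rewrite ffunE; case: (e \in H). Qed.

Lemma bn_inv_in_I D :
  (0 < bn D)%N -> I_polyhedron R D [ffun=> (bn D)%:R^-1].
Proof.
move=> bD; have b0 : 0 < (bn D)%:R :> R by rewrite ltr0n.
have dotE B : dot [ffun=> (bn D)%:R^-1] (indic R B) = #|B|%:R / (bn D)%:R.
  rewrite dot_indic; under eq_bigr do rewrite ffunE.
  by rewrite sumr_const mulr_natl.
split=> [B /minbP[_ cB]|B /bn_le_transversal cB|e].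
- by rewrite dotE cB divff ?gt_eqF.
- by rewrite dotE ler_pdivlMr // mul1r ler_nat.
- by rewrite ffunE invr_ge0 ltW.
Qed.

Lemma ideal_tilde_packing D :
  ideal R D -> (0 < bn D)%N ->
  exists y, fractional_packing (tilde D) y /\
    \sum_(H in tilde D) y H = (bn D)%:R.
Proof.
move=> Did bD; have b0 : 0 < (bn D)%:R :> R by rewrite ltr0n.
have [y [y0 ys yx]] := I_polyhedron_dominates Did (bn_inv_in_I bD).
exists (fun H => (bn D)%:R * y H); split; last by rewrite -mulr_sumr ys mulr1.
split=> [H _|e]; first by rewrite mulr_ge0 // ltW.
have := yx e; rewrite ffunE -mulr_sumr => ye.
by rewrite mulrC -ler_pdivlMr // mul1r.
Qed.

(** One inequality is monotonicity; the other is weak duality against the fractional packing of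
    [tilde D] of value [bn D]. *)
Lemma bn_tilde D :
  ideal R D -> set0 \notin D -> (0 < bn D)%N -> bn (tilde D) = bn D.
Proof.
move=> Did D0 bD; apply/eqP; rewrite eqn_leq bn_subset ?tilde_sub //=.
have [y [yp ys]] := ideal_tilde_packing Did bD.
have [B /minbP[BD <-]] := minb_exists (tilde_set0 D0).
by rewrite -(ler_nat R) -ys weak_duality.
Qed.

Lemma integral_blocking_tilde D :
  ideal R D -> set0 \notin D -> (0 < bn D)%N ->
  integral_blocking_condition R (tilde D).
Proof.
move=> Did D0 bD; split.
  have [y [yp ys]] := ideal_tilde_packing Did bD.
  by exists y; split; rewrite // bn_tilde.
have [B /minbP[BD <-]] := minb_exists (tilde_set0 D0).
by move=> y yp; apply: weak_duality.
Qed.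

(** Any transversal of [D] contains one of [tilde D], and a minimum one is also minimum for
    [tilde D] because the blocking numbers agree. *)
Lemma I_polyhedron_tilde_sub D x :
  bn (tilde D) = bn D -> I_polyhedron R (tilde D) x -> I_polyhedron R D x.
Proof.
move=> bnE [xmin x1 x0]; split=> // [B /minbP[BD cB]|B /transversal_meets_all BD].
  apply: xmin; apply/minbP; split; last by rewrite bnE.
  exact: meets_all_subset (tilde_sub D) BD.
have [B' B't sB'] := transversal_below (meets_all_subset (tilde_sub D) BD).
apply: le_trans (x1 _ B't) _; rewrite !dot_indic.
rewrite [leRHS](big_setID B') /= (setIidPr sB') lerDl.
by apply: sumr_ge0.
Qed.

(* The equations [x(B) = 1], for minimum transversals [B] covering [E], force
   the domination of [I_polyhedron_dominates] to be an equality, and then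
   restrict the support of the combination to [tilde (tilde D)]. *)
Lemma I_polyhedron_tilde_hull D x :
  ideal R D -> bn (tilde D) = bn D ->
  (forall e, exists2 B, B \in minb D & e \in B) ->
  I_polyhedron R (tilde D) x ->
  conv_hull (fun z => exists2 H, H \in tilde (tilde D) & z = indic R H) x.
Proof.
set C := tilde D => Did bnE cov Cx; have Dx := I_polyhedron_tilde_sub bnE Cx.
have [y [y0 ys yx]] := I_polyhedron_dominates Did Dx.
(* The slacks on [B] are nonnegative with sum 0: members of [C] meet [B] exactly once, so the load
   on [B] is the total weight 1, which is [x(B)]. *)
have xE e : x e = \sum_(H in C | e \in H) y H.
  have [B Bm eB] := cov e; have [xmin _ _] := Dx.
  have d0 f : f \in B -> 0 <= x f - \sum_(H in C | f \in H) y H.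
    by rewrite subr_ge0.
  apply/eqP; rewrite -subr_eq0; apply/eqP.
  apply: (psumr_eq0P d0) => //; rewrite sumrB sum_incidence -dot_indic xmin //.
  rewrite -{1}ys -sumrB big1 // => H; rewrite inE => /andP[_ /forall_inP/(_ B Bm)].
  by move=> /eqP->; rewrite mulr1 subrr.
(* Complementary slackness again, now against the minimum transversals of [C]. *)
have supp H : H \in C -> H \notin tilde C -> y H = 0.
  move=> HC; rewrite inE HC /= => /forall_inPn[B Bmin]; apply: contraNeq => yH.
  have [BC _] := minbP _ _ Bmin; apply/eqP; apply: (tight_card1 _ BC) yH => //.
  rewrite -sum_incidence ys; have [/(_ B Bmin)<- _ _] := Cx.
  rewrite dot_indic.
  by apply: ler_sum => e _.
have sumE (F : {set E} -> R) :
    \sum_(H in tilde C) y H * F H = \sum_(H in C) y H * F H.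
  rewrite [RHS](big_setID (tilde C)) /= (setIidPr (tilde_sub C)).
  rewrite [X in _ + X]big1 ?addr0 // => H /setDP[HC HtC].
  by rewrite supp ?mul0r.
apply: (@conv_hull_enum (tilde C) _ y) => //.
- by have := sumE (fun=> 1); rewrite -!mulr_suml !mulr1 => ->.
- by move=> H HC; exists H.
- move=> e; rewrite sumE xE big_mkcondr; apply: eq_bigr => H _.
  by case: (e \in H); rewrite ?mulr1 ?mulr0.
Qed.

(** The indicators of [tilde (tilde D)] are finitely many lattice points of the polyhedron, so their
    hull settles both boundedness and integrality; convexity gives the converse inclusions. *)
Lemma I_polyhedron_tilde_integral D :
  ideal R D -> bn (tilde D) = bn D ->
  (forall e, exists2 B, B \in minb D & e \in B) ->
  integral_polytope (I_polyhedron R (tilde D)).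
Proof.
move=> Did bnE cov; split=> [|x].
  exists [seq indic R H | H in tilde (tilde D)] => x; split=> [Cx|].
    apply: conv_hull_mono (I_polyhedron_tilde_hull Did bnE cov Cx).
    by move=> _ [H HC ->]; apply: image_f.
  move=> xh; apply: I_polyhedron_convex; apply: conv_hull_mono xh.
  by move=> _ /imageP[H HC ->]; apply: indic_in_I.
split=> [Cx|xh].
  apply: conv_hull_mono (I_polyhedron_tilde_hull Did bnE cov Cx).
  by move=> _ [H HC ->]; split; [apply: indic_in_I | apply: indic_lattice].
by apply: I_polyhedron_convex; apply: conv_hull_mono xh => z [].
Qed.

End Duality.

Theorem theorem3p30 (R : realType) (E : finType) (C : {set {set E}})
    (hC : clutter C)
    (hD : exists D : {set {set E}},
        [/\ clutter D, ideal R D, minimally_non_packing D & tilde D = C]) :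
  [/\ integral_blocking_condition R C,
      integral_polytope (I_polyhedron R C) &
      ~ separable C].
Proof.
have [D [_ Did Dmnp <-]] := hD.
have [D0 /(leq_ltn_trans (leq0n _)) bD] := not_packsP Dmnp.1.
have bnE := bn_tilde Did D0 bD; split.
- exact: integral_blocking_tilde.
- apply: I_polyhedron_tilde_integral => // e.
  exact: minimally_non_packing_minb_cover.
- exact: minimally_non_packing_non_separable Dmnp (tilde_sub D) bnE.
Qed.
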